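(* Let $p$ be an odd prime number and let $n\geq 2$ be an integer. Then there exist a finite $p$-group $G$, a subgroup $H$ of $G$ and a character $\lambda\in\operatorname{Lin}(H)$ such that $|G:H|=p^n$ and $\eta(\lambda^G)=\frac{p+1}{2}$.
   Context: For a finite group $G$, $\operatorname{Irr}(G)$ denotes the set of irreducible complex characters of $G$, and $\operatorname{Lin}(G)=\{\lambda\in\operatorname{Irr}(G)\mid \lambda(1)=1\}$ is the set of linear characters. For a subgroup $H$ of $G$ and a character $\lambda$ of $H$, $\lambda^G$ denotes the character of $G$ induced by $\lambda$. For a character $\Gamma$ of $G$, $\eta(\Gamma)$ denotes the number of distinct irreducible constituents of $\Gamma$. *)

(* Defs.v *)
From mathcomp Require Import all_boot all_order all_fingroup all_algebra.
From mathcomp Require Import all_solvable all_field all_character.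

Set Implicit Arguments.
Unset Strict Implicit.
Unset Printing Implicit Defensive.

(* [irr G] enumerates the irreducible characters without repetition, so counting
   indices counts distinct constituents. *)
Definition eta (gT : finGroupType) (G : {group gT}) (Gamma : 'CF(G)) : nat :=
  #|irr_constt Gamma|.

(* Main.v *)
From HB Require Import structures.
Require Import Defs.
From mathcomp Require Import all_boot all_order all_fingroup all_algebra.
From mathcomp Require Import all_solvable all_field all_character.
From mathcomp Require Import ring.

Set Implicit Arguments.
Unset Strict Implicit.
Unset Printing Implicit Defensive.

Import GroupScope GRing.Theory Num.Theory.
Local Open Scope ring_scope.

(** The number (p + 1) / 2 appears as the number of orbits of t |-> - t on the
    field 'F_p, and the construction makes these orbits count constituents.

    Let A be a normal abelian subgroup of G, let mu_t (t in 'F_p) be a line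
    mu_0 * nu ^ t of linear characters of A, with nu of order p, let
    H = A :&: ker nu, and let lambda be the common restriction of the mu_t to
    H. Then #|A : H| = p and 'Ind[A] lambda is the sum of the mu_t. If A is
    the inertia group of every mu_t, each 'Ind[G] mu_t is irreducible, and
    two of them are equal exactly when the mu_t are G-conjugate. So 'Ind[G]
    lambda has as many irreducible constituents as there are G-orbits that meet
    the line (eta_Ind_pencil), and it remains to arrange that mu_t and mu_u are
    conjugate exactly when u = t or u = - t.

    This is what translations do to parabolas. The function x ^ 2 + t x on
    'F_p, translated by s, is x ^ 2 + (t - 2 s) x + s (s - t); it is again of
    the form x ^ 2 + u x only if s = 0 and u = t, or s = t and u = - t. Take
    for G the regular wreath product of 'F_p by an additive p-group Q: its base
    group A consists of the functions from Q to 'F_p, its linear characters are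
    also given by such functions (base_char), and G acts on them by translation
    through Q (base_char_conj). With Q = 'F_p alone one has #|G : H| = p ^ 2.
    To reach p ^ n, take Q = 'F_p * 'rV['F_p]_(n - 2) and place the parabolas
    on the line where the second coordinate vanishes: a translation that moves
    this line moves the support, hence identifies no two parabolas
    (parabola_translate). *)

(** * Induction from a normal subgroup *)

Section Ind.
Variables (gT : finGroupType) (G A : {group gT}).
Hypothesis nsAG : A <| G.

(** Mackey's formula in the normal case: it turns irreducibility and equality
    of induced characters into statements about conjugation. *)
Lemma cfdot_Ind_irr (i j : Iirr A) :
  '['Ind[G] 'chi_i, 'Ind[G] 'chi_j] =
     #|A|%:R^-1 * (\sum_(y in G) ('chi_i ^ y == 'chi_j)%CF%:R).
Proof.
rewrite -cfdot_Res_l cfResInd // cfdotZl; congr (_ * _).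
rewrite cfdot_suml; apply: eq_bigr => y Gy.
by rewrite -conjg_IirrE cfdot_irr (inj_eq irr_inj).
Qed.

(** The norm of the induced character is the index of A in the inertia group,
    which is A itself. *)
Lemma free_Ind_irr (i : Iirr A) :
  (forall y, y \in G -> 'chi_i ^ y = 'chi_i -> y \in A)%CF ->
  'Ind[G] 'chi_i \in irr G.
Proof.
move=> freeA; rewrite irrEchar cfInd_char ?irr_char //= cfdot_Ind_irr.
have [sAG nAG] := andP nsAG.
rewrite (bigID (mem A)) /= addrC big1 ?add0r => [|y /andP[Gy]].
  rewrite (eq_bigl (mem A)) => [|y]; last first.
    by rewrite andb_idl // => /(subsetP sAG).
  rewrite (eq_bigr (fun=> 1)) => [|y Ay]; last by rewrite cfConjg_id ?eqxx.
  by rewrite sumr_const mulVf ?neq0CG.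
by apply: contraNeq; rewrite pnatr_eq0 eqb0 negbK => /eqP/freeA->.
Qed.

Lemma Ind_irr_eq_cfclass (i j : Iirr A) :
  'Ind[G] 'chi_i = 'Ind[G] 'chi_j ->
  exists2 y, y \in G & ('chi_i ^ y = 'chi_j)%CF.
Proof.
move=> eqI; apply/exists_eq_inP.
have: '['Ind[G] 'chi_i, 'Ind[G] 'chi_j] != 0.
  by rewrite eqI cfnorm_eq0 Ind_irr_neq0 ?normal_sub.
apply: contraR => /existsPn nconj; rewrite cfdot_Ind_irr big1 ?mulr0 // => y Gy.
by have:= nconj y; rewrite Gy /= => /negPf->.
Qed.

End Ind.

(** The residues 0, ..., (p - 1) / 2 represent the pairs {t, - t}. *)
Lemma card_image_mod_opp (p : nat) (T : finType) (F : 'F_p -> T) :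
    prime p -> odd p ->
    (forall t u, F t = F u <-> u = t \/ u = - t) ->
  #|image F predT| = ((p + 1) %/ 2)%N.
Proof.
move=> p_pr p_odd eqF; pose f (i : 'I_p./2.+1) := F i%:R.
have dbl_half : (p./2.*2.+1 = p)%N by rewrite -[RHS]odd_double_half p_odd.
have small (i : nat) : (i <= p./2)%N -> (i < p)%N.
  by move=> le_i; rewrite -dbl_half ltnS (leq_trans le_i) // -addnn leq_addr.
have f_inj : injective f.
  move=> i j /eqF eq_ij; apply/val_inj => /=.
  have [lt_i lt_j] := (ltn_ord i, ltn_ord j); rewrite !ltnS in lt_i lt_j.
  case: eq_ij => [/(congr1 val) | eq_ji].
    by rewrite /= !val_Fp_nat // !modn_small ?small.
  have /eqP: ((i + j)%:R : 'F_p) = 0 by rewrite natrD eq_ji subrr.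
  rewrite -val_eqE /= val_Fp_nat // modn_small => [|]; last first.
    by rewrite -[ltnRHS]dbl_half ltnS -addnn leq_add.
  by rewrite addn_eq0 => /andP[/eqP-> /eqP->].
have <- : #|codom f| = ((p + 1) %/ 2)%N.
  by rewrite card_codom // card_ord divn2 addn1 -{2}dbl_half /= doubleK.
apply: eq_card => y; apply/imageP/codomP => [[t _ ->] | [i ->]]; last first.
  by exists i%:R.
have tE : t = (t : nat)%:R by rewrite natr_Zp.
have lt_tp : (t < p)%N by rewrite -[p in X in (_ < X)%N]Fp_cast.
have [le_t | lt_t] := leqP t p./2.
  by exists (Ordinal (le_t : t < p./2.+1)%N); rewrite /f /= -tE.
have le_pt : (p - t < p./2.+1)%N.
  by rewrite ltnS leq_subLR -{1}dbl_half -addnn -addSn leq_add2r.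
exists (Ordinal le_pt); apply/eqF; right.
by rewrite /= natrB ?(ltnW lt_tp) // pchar_Fp_0 // sub0r -tE.
Qed.

(** Each mu t induces irreducibly, and t |-> 'Ind[G] (mu t) identifies exactly
    t with - t; its image is the set of constituents of 'Ind[G] lambda. *)
Lemma eta_Ind_pencil (gT : finGroupType) (G A H : {group gT}) (p : nat)
    (lambda : 'CF(H)) (mu : 'F_p -> 'CF(A)) :
    prime p -> odd p -> A <| G -> H \subset A ->
    'Ind[A] lambda = \sum_t mu t ->
    (forall t, mu t \in irr A) ->
    (forall t y, y \in G -> mu t ^ y = mu t -> y \in A)%CF ->
    (forall t u,
      (exists2 y, y \in G & mu t ^ y = mu u)%CF <-> u = t \/ u = - t) ->
  eta ('Ind[G] lambda) = ((p + 1) %/ 2)%N.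
Proof.
move=> p_pr p_odd nsAG sHA Ind_lambda mu_irr mu_free mu_conj.
pose F t := cfIirr ('Ind[G] (mu t)).
have irrF t : 'chi_(F t) = 'Ind[G] (mu t).
  rewrite cfIirrE // -(cfIirrE (mu_irr t)) free_Ind_irr // => y.
  by rewrite cfIirrE //; apply: mu_free.
have eqF t u : F t = F u <-> u = t \/ u = - t.
  apply: iff_trans (mu_conj t u); split=> [eqF | [y Gy mu_y]]; last first.
    by rewrite /F (cfclass_Ind (psi := mu u) nsAG) //; apply/cfclassP; exists y.
  rewrite -(cfIirrE (mu_irr t)) -(cfIirrE (mu_irr u)).
  by apply: Ind_irr_eq_cfclass => //; rewrite !cfIirrE // -!irrF eqF.
rewrite -(card_image_mod_opp p_pr p_odd eqF) /eta; apply: eq_card => i.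
have -> : 'Ind[G] lambda = \sum_t 'chi_(F t).
  rewrite -(cfIndInd _ (normal_sub nsAG) sHA) Ind_lambda linear_sum /=.
  by apply: eq_bigr => t _; rewrite irrF.
rewrite irr_consttE cfdot_suml.
under eq_bigr => t _ do rewrite cfdot_irr.
rewrite -natr_sum pnatr_eq0 sum_nat_eq0 negb_forall.
apply/existsP/imageP => [[t] | [t _ ->]]; last by exists t; rewrite eqxx.
by rewrite /= eqb0 negbK => /eqP <-; exists t.
Qed.

(** * Linear characters of the base of a wreath product *)

Lemma exists_Fp_character (p : nat) : prime p ->
  exists e : 'F_p -> algC,
    [/\ e 0 = 1, {morph e : x y / x + y >-> x * y}
      & forall x, e x = 1 -> x = 0].
Proof.
move=> p_pr; have [z z_prim] := C_prim_root_exists (prime_gt0 p_pr).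
exists (fun x : 'F_p => z ^+ x); split=> [||x /eqP]; first exact: expr0.
  move=> x y.
  rewrite -exprD -[in RHS](prim_expr_mod z_prim) -val_Fp_nat // natrD.
  by rewrite !natr_Zp.
rewrite -(expr0 z) (eq_prim_root_expr z_prim) => /eqP mod_x.
by rewrite -(natr_Zp x) -(Fp_nat_mod p_pr) mod_x mod0n.
Qed.

Section Wreath.

Variables (p : nat) (Q : finZmodType).

(** The regular wreath product of 'F_p by Q. It needs a name of its own since
    the product type already carries the direct product group law. *)
Definition wreath : Type := ({ffun Q -> 'F_p} * Q)%type.

HB.instance Definition _ := Finite.on wreath.

Implicit Types x y : wreath.

Definition wreath_mul x y : wreath :=
  ([ffun q => x.1 q + y.1 (q + x.2)], x.2 + y.2).
Definition wreath_one : wreath := (0, 0).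
Definition wreath_inv x : wreath := ([ffun q => - x.1 (q - x.2)], - x.2).

Fact wreath_mulA : associative wreath_mul.
Proof.
move=> x y z; congr (_, _); last by rewrite /= addrA.
by apply/ffunP=> q; rewrite !ffunE /= !addrA.
Qed.
Fact wreath_mul1 : left_id wreath_one wreath_mul.
Proof.
move=> [f s]; congr (_, _); last by rewrite /= add0r.
by apply/ffunP=> q; rewrite !ffunE /= add0r addr0.
Qed.
Fact wreath_mulV : left_inverse wreath_one wreath_inv wreath_mul.
Proof.
move=> [f s]; congr (_, _); last by rewrite /= addNr.
by apply/ffunP=> q; rewrite !ffunE /= addNr.
Qed.

HB.instance Definition _ :=
  Finite_isGroup.Build wreath wreath_mulA wreath_mul1 wreath_mulV.

Lemma wreathME x y : (x * y)%g = wreath_mul x y. Proof. by []. Qed.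

Definition base_set : {set wreath} := [set x : wreath | x.2 == 0].

Fact base_group_set : group_set base_set.
Proof.
apply/group_setP; split=> [|x y]; rewrite !inE // => /eqP x0 /eqP y0.
by rewrite wreathME /= x0 y0 addr0.
Qed.
Canonical base := Group base_group_set.

Lemma in_base x : (x \in base) = (x.2 == 0).
Proof. by rewrite inE. Qed.

Lemma base_normal : base <| [set: wreath].
Proof.
apply/andP; split; first exact: subsetT.
apply/subsetP=> y _; rewrite inE; apply/subsetP=> _ /imsetP[x x0 ->].
move: x0; rewrite !in_base => /eqP x0.
by rewrite conjgE !wreathME /= x0 add0r addNr.
Qed.

Lemma card_base : #|base| = (#|'F_p| ^ #|Q|)%N.
Proof.
rewrite -card_ffun -cardsT.
have <- : [set ((f, 0) : wreath) | f in [set: {ffun Q -> 'F_p}]] = base.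
  apply/setP=> -[f s]; rewrite in_base.
  apply/idP/idP=> [/imsetP[g _ /(congr1 snd)/= -> //] | /eqP /= ->].
  exact: imset_f.
by rewrite card_imset // => f g /(congr1 fst).
Qed.

Lemma index_base : #|[set: wreath] : base| = #|Q|.
Proof.
rewrite -divgS ?subsetT // cardsT card_base /= card_prod card_ffun mulKn //.
by rewrite expn_gt0 card_ord.
Qed.

Definition dot (f : {ffun Q -> 'F_p}) (v : Q -> 'F_p) : 'F_p :=
  \sum_q f q * v q.

Lemma dotDl f g v : dot (f + g) v = dot f v + dot g v.
Proof.
by rewrite -big_split; apply: eq_bigr => q _; rewrite ffunE mulrDl.
Qed.

Lemma dotDr f v w : dot f (fun q => v q + w q) = dot f v + dot f w.
Proof. by rewrite -big_split; apply: eq_bigr => q _; rewrite mulrDr. Qed.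

Lemma dotZr f c v : dot f (fun q => c * v q) = c * dot f v.
Proof. by rewrite mulr_sumr; apply: eq_bigr => q _; rewrite mulrCA. Qed.

Lemma dot_delta q v c : dot [ffun r => c * (r == q)%:R] v = c * v q.
Proof.
rewrite /dot (bigD1 q) //= ffunE eqxx mulr1 big1 ?addr0 // => r /negPf r_q.
by rewrite ffunE r_q mulr0 mul0r.
Qed.

Lemma base_mul1 x y : x \in base -> y \in base -> (x * y)%g.1 = x.1 + y.1.
Proof.
rewrite !in_base => /eqP x0 _; apply/ffunP=> q.
by rewrite wreathME !ffunE x0 addr0.
Qed.

Lemma dot_base_conj v x y :
  x \in base -> dot (x ^ y^-1)%g.1 v = dot x.1 (fun q => v (q - y.2)).
Proof.
move=> Ax; have x0 : x.2 = 0 by apply/eqP; rewrite -in_base.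
have conjE q : (x ^ y^-1)%g.1 q = x.1 (q + y.2).
  have : (x ^ y^-1)%g \in base.
    by rewrite memJ_norm ?groupV ?(subsetP (normal_norm base_normal)) ?in_setT.
  have : (x ^ y^-1 * y = y * x)%g by rewrite conjgE invgK -!mulgA mulVg mulg1.
  rewrite in_base; move: (x ^ y^-1)%g => z [/ffunP/(_ q) + _] /eqP z0.
  by rewrite !ffunE z0 addr0 addrC => /addrI.
rewrite /dot [RHS](reindex_inj (addIr y.2)).
by apply: eq_bigr => q _; rewrite conjE addrK.
Qed.

(** A faithful additive character of 'F_p; composed with dot, it identifies the
    dual of the base group with the functions from Q to 'F_p. *)
Variable e : 'F_p -> algC.
Hypothesis e0 : e 0 = 1.
Hypothesis eM : {morph e : a b / a + b >-> a * b}.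
Hypothesis e_inj : forall a, e a = 1 -> a = 0.

Section BaseChar.
Variable v : Q -> 'F_p.

Fact base_char_repr :
  mx_repr base (fun x : wreath => (e (dot x.1 v))%:M : 'M[algC]_1).
Proof.
split=> [|x y Ax Ay]; last by rewrite base_mul1 // dotDl eM scalar_mxM.
rewrite /= [dot _ _]big1 ?e0 // => q _; by rewrite ffunE mul0r.
Qed.

Definition base_char := cfRepr (MxRepresentation base_char_repr).

Lemma base_charE x : x \in base -> base_char x = e (dot x.1 v).
Proof. by move=> Ax; rewrite cfunE Ax mulr1n mxtrace_scalar. Qed.
Lemma base_char_lin : base_char \is a linear_char.
Proof. by rewrite qualifE /= cfRepr_char cfRepr1 eqxx. Qed.
End BaseChar.

Lemma base_char_irr v : base_char v \in irr base.
Proof. exact/lin_char_irr/base_char_lin. Qed.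

Lemma base_char_inj v w : base_char v = base_char w -> v =1 w.
Proof.
move=> eq_vw q; apply/eqP; rewrite -subr_eq0; apply/eqP/e_inj.
pose x : wreath := ([ffun r => 1 * (r == q)%:R], 0).
have Ax : x \in base by rewrite in_base.
move/cfunP/(_ x): eq_vw; rewrite !base_charE // !dot_delta !mul1r => e_vw.
by rewrite eM e_vw -eM subrr.
Qed.

Lemma eq_base_char v w : v =1 w -> base_char v = base_char w.
Proof.
move=> eq_vw; apply/cfun_inP=> x Ax; rewrite !base_charE //.
by congr (e _); apply: eq_bigr => q _; rewrite eq_vw.
Qed.

Lemma base_char_conj v y :
  (base_char v ^ y)%CF = base_char (fun q => v (q - y.2)).
Proof.
have nAy : y \in 'N(base).
  by rewrite (subsetP (normal_norm base_normal)) ?in_setT.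
apply/cfun_inP=> x Ax; rewrite cfConjgE // !base_charE ?dot_base_conj //.
by rewrite memJ_norm ?groupV.
Qed.

Section Pencil.
Variables (v w : Q -> 'F_p) (q0 : Q).
Hypotheses (p_pr : prime p) (w_q0 : w q0 != 0).

Definition perp_set : {set wreath} := [set x in base | dot x.1 w == 0].

Fact perp_group_set : group_set perp_set.
Proof.
apply/group_setP; split=> [|x y].
  rewrite inE group1 /= [dot _ _]big1 // => q _; by rewrite ffunE mul0r.
rewrite !inE -!in_base => /andP[Ax /eqP xw] /andP[Ay /eqP yw].
by rewrite groupM // base_mul1 // dotDl xw yw addr0 eqxx.
Qed.
Canonical perp := Group perp_group_set.

Lemma perp_sub : perp \subset base.
Proof. by apply/subsetP=> x /setIdP[]. Qed.

(** Multiplication by e c != 1 permutes the terms, so it fixes the sum. *)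
Lemma sum_e_eq0 c : c != 0 -> \sum_t e (t * c) = 0.
Proof.
move=> nz_c; apply/eqP; set S := \sum_t _.
have : e c * S = S.
  rewrite mulr_sumr [RHS](reindex_inj (addIr 1)) /=; apply: eq_bigr => t _.
  by rewrite mulrDl mul1r eM mulrC.
move/eqP; rewrite -subr_eq0 -[X in _ - X]mul1r -mulrBl mulf_eq0 subr_eq0.
by case/orP=> // /eqP/e_inj/eqP; rewrite (negPf nz_c).
Qed.

Lemma perp_normal : perp <| base.
Proof.
apply/andP; split; [exact: perp_sub | apply/subsetP=> y Ay].
rewrite inE; apply/subsetP=> _ /imsetP[x /setIdP[Ax xw] ->].
rewrite inE groupJ //= -[y]invgK dot_base_conj // -(eqP xw).
move: Ay; rewrite -groupV !in_base => /eqP ->.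
by apply/eqP; apply: eq_bigr => q _; rewrite subr0.
Qed.

(** perp is the kernel of x |-> dot x.1 w, which is onto 'F_p since w is not
    zero at q0. *)
Lemma index_perp : #|base : perp| = p.
Proof.
pose f x := dot x.1 w.
have fM : {in base &, {morph f : x y / (x * y)%g >-> (x * y)%g}}.
  by move=> x y Ax Ay; rewrite /f base_mul1 // dotDl.
pose phi := Morphism fM.
have <- : ('ker_base phi)%g = perp.
  apply/setP=> x; rewrite !inE -!in_base.
  by case: (x \in base).
rewrite indexgI; have := card_morphim phi base; rewrite setIid => <-.
rewrite -[RHS](card_Fp p_pr) -cardsT; congr #|pred_of_set _|; apply/setP=> c.
rewrite !inE; pose x : wreath := ([ffun r => (c / w q0) * (r == q0)%:R], 0).
have Ax : x \in base by rewrite in_base.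
apply/morphimP; exists x => //.
by rewrite /= /f dot_delta divfK.
Qed.

(** By the projection formula the left side is base_char v times the induced
    principal character, which is p on perp and 0 elsewhere: the same values
    as the sum over t of the characters attached to t * w. *)
Lemma Ind_perp :
  'Ind[base] ('Res[perp] (base_char v)) =
    \sum_t base_char (fun q => v q + t * w q).
Proof.
rewrite -['Res _]mul1r cfIndM ?perp_sub // cfInd_cfun1 ?perp_normal //.
rewrite index_perp.
apply/cfun_inP=> x Ax; rewrite cfunE base_charE // cfunE.
rewrite cfuniE ?perp_normal // sum_cfunE.
under eq_bigr => t _ do rewrite base_charE // dotDr dotZr eM.
rewrite -mulr_sumr mulrC; congr (_ * _).
rewrite inE Ax /=; have [-> | nz_c] := eqVneq; last by rewrite mulr0 sum_e_eq0.
under eq_bigr => t _ do rewrite mulr0 e0.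
by rewrite sumr_const card_Fp // mulr1.
Qed.

End Pencil.
End Wreath.

(** * Translates of parabolas *)

HB.instance Definition _ (U V : finZmodType) := GRing.Zmodule.on (U * V)%type.

(** The polynomial x ^ 2 + t x on the line where the second coordinate vanishes,
    extended by 0. It is written as an affine function of t, so that the
    parabolas form a line in the space of functions. *)
Definition parabola (p k : nat) (t : 'F_p) (q : 'F_p * 'rV['F_p]_k) : 'F_p :=
  (q.2 == 0)%:R * q.1 ^+ 2 + t * ((q.2 == 0)%:R * q.1).

Lemma Fp_two_neq0 (p : nat) : prime p -> odd p -> 2%:R != 0 :> 'F_p.
Proof. by move=> p_pr p_odd; rewrite -unitfE unitFpE // coprimen2. Qed.

(** The translation has to preserve the line that supports the parabolas, since
    no x ^ 2 + t x vanishes on all of 'F_p for p odd; then one compares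
    coefficients in x ^ 2 + (t - 2 s) x + s (s - t) = x ^ 2 + u x. *)
Lemma parabola_translate (p k : nat) (t u : 'F_p) (s : 'F_p * 'rV['F_p]_k) :
    prime p -> odd p ->
  (forall q, parabola t (q - s) = parabola u q) <->
    s.2 = 0 /\ (s.1 = 0 /\ u = t \/ s.1 = t /\ u = - t).
Proof.
move=> p_pr p_odd.
have nz2 := Fp_two_neq0 p_pr p_odd.
have onE (a : 'F_p) v : parabola v (a, 0 : 'rV['F_p]_k) = a ^+ 2 + v * a.
  by rewrite /parabola eqxx !mul1r.
split=> [eq_par | ].
  have s2_0 : s.2 = 0.
    apply/eqP; apply: contraR nz2 => nz_s2; apply/eqP.
    (* Off the line everything is 0; now add the values at 1 and -1. *)
    have van a : a ^+ 2 + t * a = 0.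
      rewrite -onE -[(a, _)](addrK s) eq_par /parabola /= add0r (negPf nz_s2).
      by rewrite !mul0r mulr0 addr0.
    have := van 1; have := van (-1); rewrite sqrrN expr1n mulrN1 mulr1 => v1 v2.
    have -> : 2%:R = (1 - t) + (1 + t) :> 'F_p by ring.
    by rewrite v1 v2 addr0.
  have eq_on a : (a - s.1) ^+ 2 + t * (a - s.1) = a ^+ 2 + u * a.
    rewrite -[RHS]onE -eq_par -onE; congr (parabola _ _).
    by case: (s) s2_0 => s1 s2 /= ->; congr (_, _); rewrite /= subr0.
  have u_eq : u = t - 2%:R * s.1.
    have /eqP := eq_on 1; rewrite -subr_eq0 => /eqP eq1.
    have /eqP := eq_on 0; rewrite -subr_eq0 => /eqP eq0.
    apply/eqP; rewrite -subr_eq0.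
    apply/eqP; have := congr2 (fun a b => b - a) eq1 eq0.
    by rewrite subrr => <-; ring.
  have /eqP : s.1 * (s.1 - t) = 0.
    have /eqP := eq_on 0; rewrite -subr_eq0 => /eqP eq0.
    by rewrite -[RHS]eq0; ring.
  rewrite mulf_eq0 subr_eq0 => s1E; split=> //; case/orP: s1E => /eqP s1E.
    by left; rewrite u_eq s1E mulr0 subr0.
  by right; rewrite u_eq s1E; split=> //; ring.
case: s => s1 s2 /= [-> s1E] [a b]; rewrite /parabola /= subr0.
by case: s1E => [[-> ->] | [-> ->]]; ring.
Qed.

(** * Inducing to exactly (p + 1) / 2 constituents *)

Theorem theorem4p15 (p n : nat) (p_prime : prime p) (p_odd : odd p)
    (n_ge2 : (2 <= n)%N) :
  exists (gT : finGroupType) (G H : {group gT}) (lambda : 'CF(H)),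
    [/\ (p.-group G)%g,
        H \subset G,
        lambda \is a linear_char,
        #|G : H|%g = (p ^ n)%N
      & eta ('Ind[G] lambda)%R = ((p + 1) %/ 2)%N].
Proof.
have [e [e0 eM e_inj]] := exists_Fp_character p_prime.
pose Q : finZmodType := ('F_p * 'rV['F_p]_(n - 2))%type.
pose v (q : Q) : 'F_p := (q.2 == 0)%:R * q.1 ^+ 2.
pose w (q : Q) : 'F_p := (q.2 == 0)%:R * q.1.
have w10 : w (1, 0) != 0 by rewrite /w eqxx mul1r oner_eq0.
have card_Q : #|Q| = (p ^ n.-1)%N.
  rewrite card_prod card_mx card_Fp // mul1n -expnS.
  by case: n n_ge2 {Q v w w10} => [|[|m]] //; rewrite subn2.
pose G := [set: wreath p Q]%G; pose H := perp w.
pose mu (t : 'F_p) := base_char e0 eM (parabola t : Q -> 'F_p).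
exists (wreath p Q), G, H, ('Res[H] (base_char e0 eM v)); split.
- rewrite /pgroup cardsT card_prod card_ffun card_Q card_Fp //.
  by rewrite -expnD pnatX pnat_id.
- exact: subsetT.
- by rewrite cfRes_lin_char ?base_char_lin.
- rewrite -(Lagrange_index (subsetT (base p Q)) (perp_sub w)) index_base.
  by rewrite (index_perp p_prime w10) card_Q -expnSr prednK ?(ltnW n_ge2).
have mu_conj t u (y : wreath p Q) :
  (mu t ^ y)%CF = mu u <->
    y.2.2 = 0 /\ (y.2.1 = 0 /\ u = t \/ y.2.1 = t /\ u = - t).
  rewrite base_char_conj.
  apply: iff_trans (parabola_translate t u y.2 p_prime p_odd).
  by split=> [/base_char_inj-/(_ e_inj) | /eq_base_char]; apply.
apply: (@eta_Ind_pencil _ G (base p Q) H p _ mu) => //.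
- exact: base_normal.
- exact: perp_sub.
- rewrite (Ind_perp e0 eM e_inj v p_prime w10).
  by apply: eq_bigr => t _; apply: eq_base_char.
- by move=> t; apply: base_char_irr.
- move=> t y _ /mu_conj[y20 yt]; rewrite in_base.
  (* In the case y.2.1 = t and t = - t, the parameter t is 0. *)
  have y10 : y.2.1 = 0.
    case: yt => [[] // | [-> tN]]; apply/eqP.
    have /eqP : 2%:R * t = 0 by rewrite mulr_natl mulr2n {1}tN addNr.
    by rewrite mulf_eq0 (negPf (Fp_two_neq0 p_prime p_odd)).
  by case: (y.2) y20 y10 => a b /= -> ->.
- move=> t u; split=> [[y _ /mu_conj[_ [[_ ->]|[_ ->]]]] | ].
  + by left.
  + by right.
  (* The translation by (t, 0) exchanges the parabolas of t and - t. *)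
  case=> ->; last first.
    by exists (0, (t, 0)); rewrite ?inE //; apply/mu_conj; split=> //; right.
  by exists 1%g; rewrite ?inE //; apply/mu_conj; split=> //; left.
Qed.
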